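(* Let $q$ be a fixed prime power and let $k\ge 2$ and $t\ge 0$ be fixed integers. Define the sequence $(\alpha_i)_{i\ge 0}$ by $\alpha_0=1$ and $$\alpha_i=-N_k(i)\alpha_0-N_k(i-1)\alpha_1-\cdots-N_k(1)\alpha_{i-1},\qquad i>0.$$ Then, as $m\to\infty$, $$I_k(m)=\sum_{i=0}^t\alpha_i N_k(m-i)+O\Bigl(q^{\binom{m-t-1+k}{k}}\Bigr),$$ where the $O$ concerns only the variable $m$ (the implied constant may depend on $q,k,t$ but not on $m$).
   Context: $\mathbb F_q$ is the finite field with $q$ elements. Two polynomials in $\mathbb F_q[x_1,\dots,x_k]$ are identified if they differ by a factor in $\mathbb F_q^\times$; the classes are called normalized polynomials. $\deg$ denotes the total degree. For an integer $m\ge 0$, $N_k(m)$ is the number of normalized (nonzero) polynomials in $\mathbb F_q[x_1,\dots,x_k]$ of total degree $m$; explicitly $N_k(m)=\frac{q^{\binom{m+k}{k}}-q^{\binom{m+k-1}{k}}}{q-1}$. $I_k(m)$ is the number of those that are irreducible (so $I_k(0)=0$). *)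

(* Defs.v *)
From mathcomp Require Import all_boot all_order all_algebra.
From mathcomp Require Import finmap mpoly.
From mathcomp Require Import boolp classical_sets functions cardinality.

Set Implicit Arguments.
Unset Strict Implicit.
Unset Printing Implicit Defensive.

Import GRing.Theory.
Local Open Scope classical_set_scope.
Local Open Scope ring_scope.

Section NormalizedPolynomials.
Variables (F : finFieldType) (k : nat).
Implicit Types (p a b : {mpoly F[k]}) (m : nat).

Definition mpoly_irreducible p : Prop :=
  [/\ p != 0, p \isn't a GRing.unit &
      forall a b, p = a * b -> a \is a GRing.unit \/ b \is a GRing.unit].

(* The normalized polynomial represented by p: its class modulo nonzero
   scalars. *)
Definition normalized p : set {mpoly F[k]} :=
  [set c *: p | c in [set c : F | c != 0]].

(* msize p is the total degree plus one, and 0 for the zero polynomial, so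
   msize p = m.+1 says that p is nonzero of total degree m. *)
Definition normalized_polys m : set (set {mpoly F[k]}) :=
  [set normalized p | p in [set p | msize p = m.+1]].

Definition normalized_irreducibles m : set (set {mpoly F[k]}) :=
  [set normalized p | p in [set p | msize p = m.+1 /\ mpoly_irreducible p]].

(* fset_set returns the empty set on infinite sets; the next two lemmas show
   that this case does not occur in num_normalized and num_irreducible. *)
Lemma finite_normalized_polys m : finite_set (normalized_polys m).
Proof.
apply: finite_image.
pose g (f : {ffun 'X_{1..k < m.+1} -> F}) : {mpoly F[k]} :=
  \sum_(b : 'X_{1..k < m.+1}) f b *: 'X_[b].
apply: (@sub_finite_set _ _ (g @` setT)); last exact/finite_image/finite_finset.
move=> p /= sz_p; exists [ffun b : 'X_{1..k < m.+1} => p@_b] => //.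
rewrite [RHS](@mpolywE k _ m.+1 p) ?sz_p //.
by apply: eq_bigr => b _; rewrite ffunE.
Qed.

Lemma finite_normalized_irreducibles m :
  finite_set (normalized_irreducibles m).
Proof.
apply: sub_finite_set (finite_normalized_polys m).
by move=> _ [p [sz_p _] <-]; exists p.
Qed.

Definition num_normalized m : nat := #|` fset_set (normalized_polys m)|%fset.

Definition num_irreducible m : nat :=
  #|` fset_set (normalized_irreducibles m)|%fset.

End NormalizedPolynomials.

(* Main.v *)
(* Let N m and I m count the monic and the monic irreducible polynomials of
   degree m, and put Q m = q ^ 'C(m + k, k), so that N m <= Q m.
   If m is large compared with t, a monic p of degree m either is a product
   b * a with deg b <= t and a irreducible, or has two cofactors both of degree
   > t.  The polynomials of the second kind number at most
   \sum_(t < j <= m/2) N j * N (m - j); since the exponent of Q j * Q (m - j)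
   drops at each step of j, this is at most 2 * Q t.+1 * Q (m - t.+1).  The pair
   (b, a) of the first kind is unique, because irreducible polynomials are prime
   (Gauss's lemma) and a is too large to divide the other cofactor.  Hence
   N m = \sum_(j <= t) N j * I (m - j) + O(Q (m - t - 1)),
   and convolving with alpha, the inverse of N as a power series, isolates
   I m. *)
Require Import Defs.
From mathcomp Require Import all_boot all_order all_algebra.
From mathcomp Require Import finmap mpoly.
From mathcomp Require Import boolp classical_sets cardinality.
From mathcomp Require Import zify.

Set Implicit Arguments.
Unset Strict Implicit.
Unset Printing Implicit Defensive.

Import Order.TTheory GRing.Theory Num.Theory.
Local Open Scope ring_scope.

(** * Gauss's lemma *)

(* On {mpoly F[k]} this is convertible to mpoly_irreducible. *)
Definition irreducible_elt (R : idomainType) (p : R) : Prop :=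
  [/\ p != 0, p \isn't a GRing.unit &
      forall a b, p = a * b -> a \is a GRing.unit \/ b \is a GRing.unit].

Definition divides (R : idomainType) (a b : R) : Prop := exists c, b = c * a.

(** The existence half of unique factorization; [irreducibles_prime] is the uniqueness half. *)
Definition atomic (R : idomainType) : Prop :=
  forall c : R, c != 0 -> exists (u : R) (s : seq R),
    [/\ u \is a GRing.unit, {in s, forall p, irreducible_elt p} &
        c = u * \prod_(p <- s) p].

Definition irreducibles_prime (R : idomainType) : Prop :=
  forall p a b : R, irreducible_elt p -> divides p (a * b) ->
    divides p a \/ divides p b.

Section GaussLemma.
Variable R : idomainType.
Hypotheses (atomR : atomic R) (primeR : irreducibles_prime R).
Implicit Types (p q u v : {poly R}).

(** Induction on the total size: [c] divides the product of the leading coefficients, hence one of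
    them, and removing that leading term changes nothing modulo [c]. *)
Lemma prime_const (c : R) p q :
  irreducible_elt c -> divides c%:P (p * q) -> divides c%:P p \/ divides c%:P q.
Proof.
move=> irr_c; have [n] := ubnP (size p + size q)%N.
elim: n p q => // n IHn p q szpq [r pq_cr].
have [->|p0] := eqVneq p 0; first by left; exists 0; rewrite mul0r.
have [->|q0] := eqVneq q 0; first by right; exists 0; rewrite mul0r.
have sub_size (p' : {poly R}) a : p' != 0 -> lead_coef p' = a * c ->
    (size (p' - (a *: 'X^((size p').-1)) * c%:P)%R < size p')%N.
  move=> p'0 lcE.
  have sz : (size (p' - (a *: 'X^((size p').-1)) * c%:P)%R <= size p')%N.
    apply: leq_trans (size_polyD _ _) _; rewrite size_polyN geq_max leqnn /=.
    rewrite mulrC mul_polyC scalerA.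
    apply: leq_trans (size_scale_leq _ _) _.
    by rewrite size_polyXn prednK // size_poly_gt0.
  rewrite ltn_neqAle sz andbT; apply/eqP => szE.
  set p1 := (_ - _) in sz szE.
  have : lead_coef p1 = 0.
    rewrite lead_coefE szE /p1 coefB coefMC coefZ coefXn eqxx mulr1 -lcE.
    by rewrite lead_coefE subrr.
  move/eqP; rewrite lead_coef_eq0 => /eqP p10.
  move: szE; rewrite p10 size_poly0 => /esym/eqP.
  by rewrite size_poly_eq0 (negbTE p'0).
(* c divides one of the leading coefficients: subtract that leading term. *)
have /primeR [] // : divides c (lead_coef p * lead_coef q).
- by exists (lead_coef r); rewrite -lead_coefM pq_cr lead_coefM lead_coefC.
- case=> a lcp; have szp' := sub_size p a p0 lcp.
  case: (IHn (p - (a *: 'X^((size p).-1)) * c%:P) q).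
  + by lia.
  + exists (r - (a *: 'X^((size p).-1)) * q).
    by rewrite mulrBl pq_cr mulrBl; congr (_ - _); rewrite mulrAC.
  + case=> s ps; left; exists (s + a *: 'X^((size p).-1)).
    by rewrite mulrDl -ps subrK.
  + by right.
- case=> a lcq; have szq' := sub_size q a q0 lcq.
  case: (IHn p (q - (a *: 'X^((size q).-1)) * c%:P)).
  + by lia.
  + exists (r - p * (a *: 'X^((size q).-1))).
    by rewrite mulrBr pq_cr mulrBl mulrA.
  + by left.
  + case=> s qs; right; exists (s + a *: 'X^((size q).-1)).
    by rewrite mulrDl -qs subrK.
Qed.

(* Prime factors of c are cancelled one at a time, each against u or v; this
   turns factorizations over the fraction field into factorizations over R. *)
Lemma split_constant (c : R) q u v : c != 0 -> c *: q = u * v ->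
  exists a b u' v', [/\ a != 0, b != 0, u = a *: u', v = b *: v' & q = u' * v'].
Proof.
move=> /atomR[e [s [Ue irr_s ->]]].
elim: s u v irr_s => [|p s IHs] u v irr_s.
  rewrite big_nil mulr1 => euv; exists e, 1, (e^-1 *: u), v.
  rewrite scalerA divrr // !scale1r oner_neq0 -scalerAl -euv scalerA mulVr //.
  by rewrite scale1r; split=> //; apply: contraTneq Ue => ->; rewrite unitr0.
rewrite big_cons mulrCA -scalerA => puv.
have irr_p : irreducible_elt p by apply: irr_s; rewrite mem_head.
have p0 : p != 0 by case: irr_p.
have pC0 : p%:P != 0 by rewrite polyC_eq0.
have irr_s' : {in s, forall x, irreducible_elt x}.
  by move=> r rs; apply: irr_s; rewrite inE rs orbT.
have : divides p%:P (u * v).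
  by exists ((e * \prod_(j <- s) j) *: q); rewrite -puv -mul_polyC mulrC.
case/(prime_const irr_p) => -[w wE].
- have /(IHs _ _ irr_s') [a [b [u' [v' [a0 b0 wE' vE qE]]]]] :
      (e * \prod_(j <- s) j) *: q = w * v.
    by apply: (mulfI pC0); rewrite mul_polyC puv wE mulrA (mulrC w).
  exists (p * a), b, u', v'; rewrite mulf_neq0 //; split=> //.
  by rewrite wE wE' mulrC mul_polyC scalerA.
- have /(IHs _ _ irr_s') [a [b [u' [v' [a0 b0 uE wE' qE]]]]] :
      (e * \prod_(j <- s) j) *: q = u * w.
    by apply: (mulfI pC0); rewrite mul_polyC puv wE mulrA mulrC.
  exists a, (p * b), u', v'; rewrite mulf_neq0 //; split=> //.
  by rewrite wE wE' mulrC mul_polyC scalerA.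
Qed.

Import Pdiv.Idomain.

(* Over an integral domain, p %| q only means that p divides a nonzero constant
   multiple of q. *)
Lemma irreducible_dvdp p q :
  irreducible_elt p -> (1 < size p)%N -> p %| q -> divides p q.
Proof.
move=> [p0 _ irr_p] szp /dvdpP[[c r] /= c0 /(split_constant c0)].
case=> a [b [u [v [a0 b0 _ pE ->]]]].
(* Here [p] is [b%:P * v]: if [b] is a unit it can be inverted, and if [v] is one then [p] is
   constant. *)
have [] := irr_p b%:P v; first by rewrite mul_polyC.
  rewrite poly_unitE coefC eqxx => /andP[_ Ub].
  exists (b^-1 *: u).
  by rewrite pE -scalerAl -scalerAr scalerA mulVr // scale1r.
rewrite poly_unitE -(size_scale v b0) -pE => /andP[/eqP szp1].
by rewrite szp1 in szp.
Qed.

(** Constants are handled by [prime_const]. Otherwise the gcd of [p] and [f] over the fraction field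
    yields [p = u * v] over [R], with [v] proportional to the gcd. If [u] is a unit, [p] divides
    [f]; if [v] is, then [p] and [f] are coprime over the fraction field and [p] divides [g]. *)
Lemma poly_irreducibles_prime : irreducibles_prime {poly R}.
Proof.
move=> p f g irr_p; case: (irr_p) => p0 Up irrp p_fg.
have [szp|szp] := leqP (size p) 1.
  have pE := size1_polyC szp; rewrite pE in p_fg *.
  apply: prime_const p_fg; split.
  - by rewrite -polyC_eq0 -pE.
  - by apply: contra Up; rewrite [in X in _ -> X]pE; apply: rmorph_unit.
  - move=> a b ab; have [] := irrp a%:P b%:P; first by rewrite -polyCM -ab.
      by rewrite poly_unitE coefC eqxx => /andP[_]; left.
    by rewrite poly_unitE coefC eqxx => /andP[_]; right.
have /dvdpP[[c r] /= c0 /(split_constant c0)] := dvdp_gcdl p f.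
case=> a [b [u [v [a0 b0 rE dE pE]]]].
case: (irrp u v pE) => [Uu|Uv].
  left; apply: irreducible_dvdp => //.
  apply: dvdp_trans (dvdp_gcdr p f); rewrite dE dvdpZr // pE.
  by apply/dvdpP; exists (1, u^-1); rewrite ?oner_neq0 //= scale1r mulKr.
right; apply: irreducible_dvdp => //; rewrite -(@Gauss_dvdpr _ g f).
  by case: p_fg => h ->; apply: dvdp_mull.
rewrite coprimep_def dE size_scale //.
by move: Uv; rewrite poly_unitE => /andP[].
Qed.

End GaussLemma.

(** Transport along a ring isomorphism, to be applied to [muni]; identities about [g] are checked
    after applying the injective [f]. *)
Lemma irreducibles_prime_iso (A B : idomainType) (f : {rmorphism A -> B})
    (g : B -> A) : cancel f g -> cancel g f ->
  irreducibles_prime B -> irreducibles_prime A.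
Proof.
move=> fK gK primeB p a b [p0 Up irr_p] [c abE].
have f_inj := can_inj fK.
have Uf x : f x \is a GRing.unit -> x \is a GRing.unit.
  move=> Ux; apply/unitrP; exists (g (f x)^-1).
  by split; apply: f_inj; rewrite rmorphM gK rmorph1 ?mulVr ?mulrV.
have irr_fp : irreducible_elt (f p).
  split=> [||x y fpE]; first by rewrite -(rmorph0 f) (inj_eq f_inj).
    by apply: contra Up; apply: Uf.
  have [] := irr_p (g x) (g y); first by apply: f_inj; rewrite rmorphM !gK.
    by move/(rmorph_unit f); rewrite gK; left.
  by move/(rmorph_unit f); rewrite gK; right.
have [] := primeB _ (f a) (f b) irr_fp.
- by exists (f c); rewrite -!rmorphM abE.
- by case=> d fa; left; exists (g d); apply: f_inj; rewrite rmorphM gK.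
- by case=> d fb; right; exists (g d); apply: f_inj; rewrite rmorphM gK.
Qed.

(** * Irreducible multivariate polynomials are prime *)

Section MultivariateFactorization.
Variable F : fieldType.

Lemma mpoly_unit_msize n (p : {mpoly F[n]}) :
  (p \is a GRing.unit) = (msize p == 1%N).
Proof.
apply/idP/idP => [Up|/eqP szp].
  have p0 : p != 0 by apply: contraTneq Up => ->; rewrite unitr0.
  have pV0 : p^-1 != 0 by rewrite invr_eq0.
  have := msizeM p0 pV0; rewrite divrr // msize1.
  rewrite (mpolySpred _ p0) (mpolySpred _ pV0) addnS addSn /=.
  by move=> /esym[/eqP]; rewrite addn_eq0 eqSS => /andP[].
have pE : p = (p@_0)%:MP by apply: msize1_polyC; rewrite szp.
rewrite pE; apply: rmorph_unit; rewrite unitfE -(mpolyC_eq0 n) -pE.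
by rewrite -msize_poly_eq0 szp.
Qed.

(** Induction on the degree: nonunits have positive degree, so both factors of a reducible
    polynomial have smaller degree. *)
Lemma mpoly_atomic n : atomic {mpoly F[n]}.
Proof.
move=> p; have [d] := ubnP (msize p); elim: d p => // d IHd p szp p0.
have [Up|Up] := boolP (p \is a GRing.unit).
  by exists p, [::]; split=> //; rewrite big_nil mulr1.
have [irr_p|] := pselect (irreducible_elt p).
  exists 1, [:: p]; rewrite unitr1 big_seq1 mul1r; split=> // r.
  by rewrite inE => /eqP->.
move=> Nirr.
have [a [b [pE Ua Ub]]] : exists a b,
    [/\ p = a * b, a \isn't a GRing.unit & b \isn't a GRing.unit].
  apply: contrapT => Nab; apply: Nirr; split=> // a b pE.
  have [Ua|Ua] := boolP (a \is a GRing.unit); first by left.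
  have [Ub|Ub] := boolP (b \is a GRing.unit); first by right.
  by case: Nab; exists a, b.
have /norP[a0 b0] : ~~ ((a == 0) || (b == 0)) by rewrite -mulf_eq0 -pE.
move: Ua Ub; rewrite !mpoly_unit_msize => Ua Ub.
have szE := msizeM a0 b0; rewrite -pE in szE.
move: Ua Ub szE szp.
have a0' := a0; have b0' := b0.
rewrite -!msize_poly_eq0 in a0' b0'.
move: a0' b0'.
set x := msize a; set y := msize b; set z := msize p => a0' b0' Ua Ub szE szp.
have [|u1 [s1 [Uu1 irr1 aE]]] := IHd a _ a0; first by lia.
have [|u2 [s2 [Uu2 irr2 bE]]] := IHd b _ b0; first by lia.
exists (u1 * u2), (s1 ++ s2); split; first by rewrite unitrM Uu1.
  by move=> r; rewrite mem_cat => /orP[/irr1|/irr2].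
by rewrite big_cat pE aE bE mulrACA.
Qed.

(** * Polynomials in n + 1 variables as polynomials in the last one *)

Section LastVariable.
Variable n : nat.
Local Notation widen := (widen_ord (leqnSn n)).

(** The inverse of [muni], as [poly_to_mpolyK] and [muniK] show. *)
Definition poly_to_mpoly (p : {poly {mpoly F[n]}}) : {mpoly F[n.+1]} :=
  (map_poly (@mwiden n F) p).['X_ord_max].

Lemma muniX (i : 'I_n) : muni ('X_(widen i) : {mpoly F[n.+1]}) = ('X_i)%:P.
Proof.
rewrite muniE msuppX big_seq1 mcoeffX eqxx scale1r.
have -> : U_(widen i)%MM ord_max = 0%N.
  by rewrite mnmE; apply/eqP; rewrite eqb0 -val_eqE /= ltn_eqF.
rewrite expr0 -mul_polyC mulr1.
congr (('X_[_])%:P); apply/mnmP => j; rewrite !mnmE.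
by rewrite [LHS]/= eqE.
Qed.

Lemma muni_mwiden (p : {mpoly F[n]}) : muni (mwiden p) = p%:P.
Proof.
rewrite [in RHS](mpolyE p) [in LHS](mpolyE p).
rewrite (raddf_sum (@mwiden n F)) (raddf_sum (@muni n F)) raddf_sum /=.
apply: eq_bigr => m _; rewrite mwidenZ muniZ -mul_mpolyC polyCM mul_polyC.
congr (_ *: _); rewrite mpolyXE_id !rmorph_prod /=; apply: eq_bigr => i _.
rewrite !rmorphXn /=; congr (_ ^+ _); rewrite mwidenX mnmwiden1.
exact: muniX.
Qed.

Lemma muniX_last : muni ('X_ord_max : {mpoly F[n.+1]}) = 'X.
Proof.
rewrite muniE msuppX big_seq1 mcoeffX eqxx scale1r mnmE eqxx expr1.
rewrite (_ : [multinom _ | i < n] = 0%MM) ?mpolyX0 ?scale1r //.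
by apply/mnmP => j; rewrite !mnmE eqE /= gtn_eqF.
Qed.

Lemma poly_to_mpolyK : cancel poly_to_mpoly (@muni n F).
Proof.
move=> p; rewrite /poly_to_mpoly horner_coef size_map_inj_poly ?mwiden0 //;
  last exact: inj_mwiden.
rewrite raddf_sum -[RHS]coefK poly_def; apply: eq_bigr => i _ /=.
rewrite coef_map /= muniM muni_mwiden rmorphXn /= muniX_last.
by rewrite mul_polyC.
Qed.

Lemma muniK : cancel (@muni n F) poly_to_mpoly.
Proof.
move=> p; rewrite [in LHS](mpolyE p) [RHS](mpolyE p) !raddf_sum.
rewrite /poly_to_mpoly rmorph_sum horner_sum.
apply: eq_bigr => m _ /=; rewrite muniZ -mul_polyC !rmorphM /= map_polyC /=.
rewrite hornerM hornerC mwidenC mul_mpolyC; congr (_ *: _).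
rewrite mpolyXE_id !rmorph_prod horner_prod /=; apply: eq_bigr => i _.
rewrite !rmorphXn horner_exp /=; congr (_ ^+ _).
case: (unliftP ord_max i) => [j|] ->.
  have -> : lift ord_max j = widen j.
    by apply: val_inj; rewrite /= /bump leqNgt ltn_ord.
  by rewrite muniX map_polyC hornerC /= mwidenX mnmwiden1.
by rewrite muniX_last map_polyX hornerX.
Qed.

End LastVariable.

(** Induction on the number of variables, by Gauss's lemma and the isomorphism [muni]. Without
    variables every nonzero polynomial is a unit, so nothing is irreducible. *)
Lemma mpoly_irreducibles_prime n : irreducibles_prime {mpoly F[n]}.
Proof.
elim: n => [|n IHn].
  move=> p a b [p0 Up _]; case/negP: Up; rewrite mpoly_unit_msize.
  rewrite -mlead_deg // eqSS; apply/eqP; rewrite mdegE big_ord0 //.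
apply: (irreducibles_prime_iso (@muniK n) (@poly_to_mpolyK n)).
exact: (poly_irreducibles_prime (@mpoly_atomic n) IHn).
Qed.

End MultivariateFactorization.

(** * Counting monic polynomials *)

Section MonicPolynomials.
Variables (F : finFieldType) (k : nat).
Implicit Types (p a b : {mpoly F[k]}) (m j t : nat).

(** Each class of nonzero polynomials modulo scalars has exactly one monic member, so monic
    polynomials count the classes; unlike classes, they multiply directly. *)
Definition monic_of_degree m : set {mpoly F[k]} :=
  [set p | msize p = m.+1 /\ mleadc p = 1]%classic.

Definition monic_irreducible m : set {mpoly F[k]} :=
  [set p | monic_of_degree m p /\ mpoly_irreducible p]%classic.

Lemma mcoeff_msize_inj m :
  {in [pred p : {mpoly F[k]} | (msize p <= m)%N] &,
    injective (fun p : {mpoly F[k]} => [ffun b : 'X_{1..k < m} => p@_b])}.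
Proof.
move=> p q szp szq /ffunP pq; rewrite (mpolywE szp) (mpolywE szq).
by apply: eq_bigr => b _; have := pq b; rewrite !ffunE => ->.
Qed.

Lemma finite_monic m : finite_set (monic_of_degree m).
Proof.
pose f (p : {mpoly F[k]}) := [ffun b : 'X_{1..k < m.+1} => p@_b].
have f_inj : {in monic_of_degree m &, injective f}.
  move=> p q; rewrite !inE => -[szp _] [szq _].
  by apply: mcoeff_msize_inj; rewrite inE ?szp ?szq.
rewrite -(eq_finite_set (inj_card_eq f_inj)).
exact: finite_finset.
Qed.

Lemma finite_monic_irreducible m : finite_set (monic_irreducible m).
Proof. by apply: sub_finite_set (finite_monic m) => p []. Qed.

Definition monics m : seq {mpoly F[k]} := fset_set (monic_of_degree m).
Definition monic_irreds m : seq {mpoly F[k]} := fset_set (monic_irreducible m).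

Lemma monicsP m p : reflect (msize p = m.+1 /\ mleadc p = 1) (p \in monics m).
Proof.
rewrite /monics (in_fset_set (finite_monic m)).
by apply: (iffP idP); rewrite inE.
Qed.

Lemma monic_irredsP m p :
  reflect ([/\ msize p = m.+1, mleadc p = 1 & mpoly_irreducible p])
    (p \in monic_irreds m).
Proof.
rewrite /monic_irreds (in_fset_set (finite_monic_irreducible m)).
by apply: (iffP idP); rewrite inE; [case=> -[] | case].
Qed.

Lemma mleadc_neq0 p : mleadc p = 1 -> p != 0.
Proof. by move=> lcp; rewrite -mleadc_eq0 lcp oner_neq0. Qed.

Lemma normalized_monic_inj p q :
  mleadc p = 1 -> mleadc q = 1 -> normalized p = normalized q -> p = q.
Proof.
move=> lcp lcq pq; have : normalized q p.
  by rewrite -pq; exists 1; rewrite /= ?oner_neq0 ?scale1r.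
case=> c _ cqp; move: lcp; rewrite -cqp mleadcZE lcq mulr1 => ->.
by rewrite scale1r.
Qed.

Lemma normalizedZ c p : c != 0 -> normalized (c *: p) = normalized p.
Proof.
move=> c0; rewrite /normalized; apply/seteqP; split => _ [d /= d0 <-].
  by exists (d * c); rewrite ?scalerA //= mulf_neq0.
by exists (d / c); rewrite /= ?mulf_neq0 ?invr_eq0 // scalerA divfK.
Qed.

Lemma mpoly_irreducibleZ c p :
  c != 0 -> mpoly_irreducible p -> mpoly_irreducible (c *: p).
Proof.
move=> c0 [p0 Up irr_p]; split.
- by rewrite mscalerI (negbTE c0).
- by move: Up; rewrite !mpoly_unit_msize msizeZ.
- move=> a b cp; have [] := irr_p (c^-1 *: a) b.
  + by rewrite -scalerAl -cp scalerA mulVf ?scale1r.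
  + by rewrite !mpoly_unit_msize msizeZ ?invr_eq0 //; left.
  + by right.
Qed.

Lemma num_normalizedE m : num_normalized F k m = size (monics m).
Proof.
have -> : num_normalized F k m =
    #|` fset_set (@normalized F k @` monic_of_degree m)%classic|%fset.
  congr (#|` fset_set _|%fset); apply/seteqP; split => _ [p pm <-].
    have p0 : p != 0 by rewrite -msize_poly_eq0 pm.
    have lc0 : (mleadc p)^-1 != 0 by rewrite invr_eq0 mleadc_eq0.
    exists ((mleadc p)^-1 *: p); last exact: normalizedZ.
    by split; rewrite ?msizeZ // mleadcZE mulVf ?mleadc_eq0.
  by exists p => //; case: pm.
rewrite fset_set_image; last exact: finite_monic.
rewrite card_in_imfset //= => p q.
rewrite !(in_fset_set (finite_monic m)) !inE => -[_ lcp] [_ lcq].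
exact: normalized_monic_inj.
Qed.

Lemma num_irreducibleE m : num_irreducible F k m = size (monic_irreds m).
Proof.
have -> : num_irreducible F k m =
    #|` fset_set (@normalized F k @` monic_irreducible m)%classic|%fset.
  congr (#|` fset_set _|%fset); apply/seteqP; split => _ [p pm <-].
    case: pm => szp irr_p; have [p0 _ _] := irr_p.
    have lc0 : (mleadc p)^-1 != 0 by rewrite invr_eq0 mleadc_eq0.
    exists ((mleadc p)^-1 *: p); last exact: normalizedZ.
    split; last exact: mpoly_irreducibleZ.
    by split; rewrite ?msizeZ // mleadcZE mulVf ?mleadc_eq0.
  by exists p => //; case: pm => -[].
rewrite fset_set_image; last exact: finite_monic_irreducible.
rewrite card_in_imfset //= => p q.
rewrite !(in_fset_set (finite_monic_irreducible m)) !inE.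
by move=> -[[_ lcp] _] [[_ lcq] _]; exact: normalized_monic_inj.
Qed.

(** The entries of an exponent vector form a [k]-tuple over 0..m with sum at most [m]; stars and
    bars counts these. *)
Lemma card_bmultinom m : (#|{: 'X_{1..k < m.+1}}| <= 'C(m + k, k))%N.
Proof.
rewrite addnC -card_partial_ord_partitions.
pose f (b : 'X_{1..k < m.+1}) : k.-tuple 'I_m.+1 := [tuple inord (b i) | i < k].
have bound (b : 'X_{1..k < m.+1}) i : (b i < m.+1)%N.
  apply: leq_ltn_trans (bmdeg b); rewrite mdegE (bigD1 i) //= leq_addr //.
have f_inj : injective f.
  move=> b c fbc; apply/val_inj/mnmP => i.
  have /(congr1 (fun x => val (tnth x i))) := fbc.
  by rewrite !tnth_mktuple /= !inordK.
rewrite -(card_imset _ f_inj).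
apply/subset_leq_card/fintype.subsetP => _ /imsetP[b _ ->].
rewrite inE big_tuple (eq_bigr (fun i => b i)) => [|i _].
  by rewrite -mdegE -ltnS bmdeg.
by rewrite tnth_mktuple /= inordK.
Qed.

Lemma num_normalized_le m : (num_normalized F k m <= #|F| ^ 'C(m + k, k))%N.
Proof.
rewrite num_normalizedE.
pose f (p : {mpoly F[k]}) := [ffun b : 'X_{1..k < m.+1} => p@_b].
have f_inj : {in monics m &, injective f}.
  move=> p q /monicsP[szp _] /monicsP[szq _].
  by apply: mcoeff_msize_inj; rewrite inE ?szp ?szq.
rewrite -(size_map f); apply: (@leq_trans #|{ffun 'X_{1..k < m.+1} -> F}|).
  rewrite -(card_uniqP _) ?max_card // map_inj_in_uniq //.
  exact: fset_uniq.
rewrite card_ffun leq_pexp2l ?card_bmultinom //.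
by apply/card_gt0P; exists 0.
Qed.

(** The constant term of the generating series; its being 1 lets [alpha] invert the series. *)
Lemma num_normalized0 : num_normalized F k 0 = 1%N.
Proof.
rewrite num_normalizedE -[RHS]/(size [:: 1 : {mpoly F[k]}]).
apply/perm_size/uniq_perm => //; first exact: fset_uniq.
move=> p; rewrite inE; apply/monicsP/eqP => [[szp lcp]|->].
  have pE : p = (p@_0)%:MP by apply: msize1_polyC; rewrite szp.
  by move: lcp; rewrite pE mleadcC => ->.
by rewrite msize1 mleadc1.
Qed.

End MonicPolynomials.

(** * Large irreducible factors *)

Section FactorizationCounting.
Variables (F : finFieldType) (k : nat).
Implicit Types (p a b : {mpoly F[k]}) (m j t : nat).

Local Notation N := (num_normalized F k).
Local Notation I := (num_irreducible F k).

(* Junk value: deg 0 = 0. *)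
Definition deg p : nat := (msize p).-1.

Lemma mleadc_mul p a : p != 0 -> a != 0 ->
  mleadc (p * a) = mleadc p * mleadc a.
Proof. by move=> p0 a0; rewrite mleadM // mleadcM. Qed.

Lemma deg_mul p a : p != 0 -> a != 0 -> deg (p * a) = (deg p + deg a)%N.
Proof.
move=> p0 a0; rewrite /deg msizeM // (mpolySpred _ p0) (mpolySpred _ a0).
by rewrite addnS.
Qed.

Lemma msize_deg p : mleadc p = 1 -> msize p = (deg p).+1.
Proof. by move=> /mleadc_neq0 p0; rewrite /deg -mpolySpred. Qed.

Lemma monicsE m p : (p \in monics F k m) = (mleadc p == 1) && (deg p == m).
Proof.
apply/monicsP/andP => [[szp ->]|[/eqP lcp /eqP dp]].
  by rewrite /deg szp !eqxx.
by rewrite lcp msize_deg // dp.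
Qed.

Lemma monic_unit_eq1 p : mleadc p = 1 -> p \is a GRing.unit -> p = 1.
Proof.
move=> lcp; rewrite mpoly_unit_msize => /eqP szp.
have pE : p = (p@_0)%:MP by apply: msize1_polyC; rewrite szp.
by move: lcp; rewrite pE mleadcC => ->.
Qed.

Definition monics_range i n : seq {mpoly F[k]} :=
  flatten [seq monics F k j | j <- iota i n].

Lemma mem_monics_range i n p :
  (p \in monics_range i n) = (mleadc p == 1) && (i <= deg p < i + n)%N.
Proof.
apply/flattenP/andP => [[_ /mapP[j + ->]]|[lcp dp]].
  by rewrite mem_iota monicsE => jin /andP[-> /eqP->].
exists (monics F k (deg p)); last by rewrite monicsE lcp eqxx.
by apply: map_f; rewrite mem_iota.
Qed.

Lemma uniq_monics_range i n : uniq (monics_range i n).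
Proof.
elim: n i => // n IHn i; rewrite [monics_range _ _]/= cat_uniq fset_uniq.
rewrite [uniq _](IHn i.+1) andbT; apply/hasPn => p.
rewrite [_ \in flatten _](mem_monics_range i.+1 n) => /andP[_ /andP[ip _]].
by apply/negP => /=; rewrite monicsE => /andP[_ /eqP dp]; rewrite dp ltnn in ip.
Qed.

(** [G] is indexed by the degree of the first factor because the second has degree [m - deg b]; it
    lists irreducibles or all monics in the two uses. *)
Definition products i n (G : nat -> seq {mpoly F[k]}) :
    seq ({mpoly F[k]} * {mpoly F[k]}) :=
  [seq (b, a) | b <- monics_range i n, a <- G (deg b)].

Lemma size_products i n G :
  size (products i n G) = (\sum_(i <= j < i + n) N j * size (G j))%N.
Proof.
rewrite size_allpairs_dep sumnE big_map big_flatten big_map.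
rewrite /index_iota addKn; apply: eq_bigr => j _.
rewrite num_normalizedE -sum1_size big_distrl /= big_seq [RHS]big_seq.
by apply: eq_bigr => p; rewrite monicsE mul1n => /andP[_ /eqP->].
Qed.

Lemma uniq_products i n G : (forall j, uniq (G j)) -> uniq (products i n G).
Proof.
move=> uG; apply: allpairs_uniq_dep => //; first exact: uniq_monics_range.
by move=> [b a] [b' a'] _ _ [-> ->].
Qed.

Lemma mem_products i n G b a :
  ((b, a) \in products i n G) =
  [&& mleadc b == 1, (i <= deg b < i + n)%N & a \in G (deg b)].
Proof.
rewrite andbA -mem_monics_range; apply/allpairsPdep/andP.
  by case=> x [y [xin yin [-> ->]]].
by case=> bin ain; exists b, a.
Qed.

(** By primality [p] divides [b'] or [p']. The first is impossible, as deg p >= m - t > t >= deg b';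
    in the second case, both being monic and irreducible, they are equal. *)
Lemma large_irreducible_factor_inj m t b p b' p' : (2 * t < m)%N ->
  (deg b <= t)%N -> (deg b' <= t)%N -> mleadc b = 1 -> mleadc b' = 1 ->
  p \in monic_irreds F k (m - deg b) -> p' \in monic_irreds F k (m - deg b') ->
  b * p = b' * p' -> p = p'.
Proof.
move=> tm bt bt' lcb lcb' /monic_irredsP[szp lcp irr_p].
move=> /monic_irredsP[szp' lcp' irr_p'] bpE.
have [] := mpoly_irreducibles_prime irr_p (a := b') (b := p').
- by exists b; rewrite -bpE.
- case=> c b'E; have b'0 := mleadc_neq0 lcb'; have p0 := mleadc_neq0 lcp.
  have c0 : c != 0 by apply: contra_neq b'0 => c0; rewrite b'E c0 mul0r.
  have := deg_mul c0 p0; rewrite -b'E [deg p]/deg szp /=; lia.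
case=> c p'E; have [_ _ irr] := irr_p'; case: (irr _ _ p'E) => [Uc|Up].
  have c1 : c = 1.
    apply: monic_unit_eq1 => //; move: lcp'; rewrite p'E mleadc_mul.
    - by rewrite lcp mulr1.
    - by apply: contraTneq Uc => ->; rewrite unitr0.
    - exact: mleadc_neq0.
  by rewrite p'E c1 mul1r.
by case: irr_p => _ /negP.
Qed.

(** Multiplication is injective on pairs of a small monic and a large monic irreducible, and lands
    in the monics of degree [m]. *)
Lemma sum_large_irreducible_factor_le m t : (2 * t < m)%N ->
  (\sum_(j < t.+1) N j * I (m - j) <= N m)%N.
Proof.
move=> tm; pose S := products 0 t.+1 (fun j => monic_irreds F k (m - j)).
have -> : (\sum_(j < t.+1) N j * I (m - j) = size S)%N.
  rewrite size_products add0n big_mkord.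
  by apply: eq_bigr => j _; rewrite num_irreducibleE.
rewrite num_normalizedE -(size_map (fun x => x.1 * x.2)).
apply: uniq_leq_size.
  rewrite map_inj_in_uniq => [|[b p] [b' p']].
    by apply: uniq_products => j; exact: fset_uniq.
  rewrite !mem_products /= => /and3P[/eqP lcb bt pin].
  move=> /and3P[/eqP lcb' bt' pin'] bpE.
  have pp' := large_irreducible_factor_inj tm bt bt' lcb lcb' pin pin' bpE.
  have p0 : p' != 0 by case/monic_irredsP: pin' => _ /mleadc_neq0.
  by rewrite pp' in bpE *; rewrite (mulIf p0 bpE).
move=> _ /mapP[[b p] + ->]; rewrite mem_products /= add0n ltnS.
move=> /and3P[/eqP lcb bt /monic_irredsP[szp lcp _]].
have b0 := mleadc_neq0 lcb; have p0 := mleadc_neq0 lcp.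
rewrite monicsE mleadc_mul // deg_mul // lcb lcp mulr1 eqxx [deg p]/deg szp /=.
by rewrite subnKC //; lia.
Qed.

Lemma monic_factorization a : mleadc a = 1 -> (0 < deg a)%N ->
  mpoly_irreducible a \/
  exists c d, [/\ a = c * d, mleadc c = 1, mleadc d = 1,
                 (0 < deg d)%N & (deg d <= deg c)%N].
Proof.
move=> lca da.
have [irr_a|Nirr] := pselect (mpoly_irreducible a); [by left|right].
have a0 := mleadc_neq0 lca.
have [c [d [aE Uc Ud]]] : exists c d,
    [/\ a = c * d, c \isn't a GRing.unit & d \isn't a GRing.unit].
  apply: contrapT => Ncd; apply: Nirr; split=> // [|c d aE].
    by rewrite mpoly_unit_msize msize_deg // eqSS -lt0n.
  have [Uc|Uc] := boolP (c \is a GRing.unit); first by left.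
  have [Ud|Ud] := boolP (d \is a GRing.unit); first by right.
  by case: Ncd; exists c, d.
have /norP[c0 d0] : ~~ ((c == 0) || (d == 0)) by rewrite -mulf_eq0 -aE.
have lcd : mleadc c * mleadc d = 1 by rewrite -mleadc_mul // -aE.
have lcc0 : mleadc c != 0 by rewrite mleadc_eq0.
have lcd0 : mleadc d != 0 by rewrite mleadc_eq0.
have deg_gt0 (x : {mpoly F[k]}) :
    x != 0 -> x \isn't a GRing.unit -> (0 < deg x)%N.
  by move=> x0; rewrite mpoly_unit_msize (mpolySpred _ x0) eqSS -lt0n.
have main x y : c * d = x * y -> x != 0 -> y != 0 -> mleadc x * mleadc y = 1 ->
    y \isn't a GRing.unit -> (deg y <= deg x)%N ->
  exists c d, [/\ a = c * d, mleadc c = 1, mleadc d = 1,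
                 (0 < deg d)%N & (deg d <= deg c)%N].
  move=> xyE x0 y0 lcxy Uy yx.
  have lcx0 : mleadc x != 0 by rewrite mleadc_eq0.
  have lcy0 : mleadc y != 0 by rewrite mleadc_eq0.
  (* The leading coefficients of [x] and [y] are mutually inverse, so scaling each polynomial by the
     other's makes both monic and keeps the product. *)
  exists (mleadc y *: x), (mleadc x *: y).
  rewrite !mleadcZE /deg !msizeZ // (mulrC (mleadc y)) lcxy; split=> //.
    by rewrite -scalerAl -scalerAr scalerA (mulrC (mleadc y)) lcxy scale1r aE.
  exact: deg_gt0.
have [dc|cd] := leqP (deg d) (deg c); first exact: (main c d).
by apply: (main d c) => //; rewrite 1?mulrC // ltnW.
Qed.

Lemma irreducible_factor_or_balanced m t p : (3 * t + 2 <= m)%N ->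
    p \in monics F k m ->
  (exists b a, [/\ p = b * a, mleadc b = 1, (deg b <= t)%N &
                  a \in monic_irreds F k (m - deg b)]) \/
  (exists b a, [/\ p = b * a, mleadc b = 1, mleadc a = 1 &
                  (t < deg b)%N /\ (t < deg a)%N]).
Proof.
move=> tm; rewrite monicsE => /andP[/eqP lcp /eqP dp].
have step b a : p = b * a -> mleadc b = 1 -> mleadc a = 1 -> (deg b <= t)%N ->
    (exists b a, [/\ p = b * a, mleadc b = 1, (deg b <= t)%N &
                  a \in monic_irreds F k (m - deg b)]) \/
    (exists b a, [/\ p = b * a, mleadc b = 1, mleadc a = 1 &
                  (t < deg b)%N /\ (t < deg a)%N]).
  (* Move the smaller factor of a into b until a is irreducible or deg b > t. *)
  have [n] := ubnP (t - deg b); elim: n b a => // n IHn b a tbn pE lcb lca bt.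
  have b0 := mleadc_neq0 lcb; have a0 := mleadc_neq0 lca.
  have da : (m = deg b + deg a)%N by rewrite -dp pE deg_mul.
  have [|irr_a|[c [d [aE lcc lcd d_gt0 dc]]]] := monic_factorization lca.
  - by lia.
  - left; exists b, a; split=> //; apply/monic_irredsP; split=> //.
    by rewrite msize_deg // da addKn.
  have c0 := mleadc_neq0 lcc; have d0 := mleadc_neq0 lcd.
  have dcd : deg a = (deg c + deg d)%N by rewrite aE deg_mul.
  have dbd : deg (b * d) = (deg b + deg d)%N by rewrite deg_mul.
  have pE' : p = (b * d) * c by rewrite pE aE -mulrA (mulrC d).
  have lcbd : mleadc (b * d) = 1 by rewrite mleadc_mul // lcb lcd mulr1.
  have [bdt|bdt] := leqP (deg (b * d)) t.
    by apply: (IHn (b * d) c) => //; lia.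
  (* Here deg c is at least half of deg a >= m - t >= 2 * t + 2, hence exceeds [t]; this is where
     the bound 3 * t + 2 comes from. *)
  right; exists (b * d), c; split=> //; split=> //.
  by clear -tm da dcd dc bt; lia.
by apply: (step 1 p); rewrite ?mul1r ?mleadc1 // /deg msize1.
Qed.

(** Every monic polynomial of degree [m] is a product from [S] or [S']; repetitions only increase
    the right side. Listing the smaller factor first in [S'] stops the sum at m/2. *)
Lemma le_sum_large_irreducible_factor m t : (3 * t + 2 <= m)%N ->
  (N m <= \sum_(j < t.+1) N j * I (m - j)
          + \sum_(t.+1 <= j < (m./2).+1) N j * N (m - j))%N.
Proof.
move=> tm; pose S := products 0 t.+1 (fun j => monic_irreds F k (m - j)).
pose S' := products t.+1 (m./2 - t) (fun j => monics F k (m - j)).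
have -> : (\sum_(j < t.+1) N j * I (m - j) = size S)%N.
  rewrite size_products add0n big_mkord.
  by apply: eq_bigr => j _; rewrite num_irreducibleE.
have -> : (\sum_(t.+1 <= j < (m./2).+1) N j * N (m - j) = size S')%N.
  rewrite size_products addSn subnKC; last by lia.
  by apply: eq_bigr => j _; rewrite -num_normalizedE.
rewrite -size_cat num_normalizedE -(size_map (fun x => x.1 * x.2) (S ++ S')).
apply: uniq_leq_size => [|p pm]; first exact: fset_uniq.
have dp : deg p = m by move: pm; rewrite monicsE => /andP[_ /eqP].
case: (irreducible_factor_or_balanced tm pm) => -[b [a [pE lcb]]].
  move=> bt ain; apply/mapP; exists (b, a) => //.
  by rewrite mem_cat mem_products lcb eqxx ltnS bt ain.
move=> lca [tb ta].
have da : m = (deg b + deg a)%N.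
  by rewrite -dp pE deg_mul //; apply: mleadc_neq0.
have main x y : p = x * y -> mleadc x = 1 -> mleadc y = 1 ->
    (t < deg x)%N -> (deg x <= deg y)%N -> m = (deg x + deg y)%N ->
    p \in [seq x.1 * x.2 | x <- S ++ S'].
  move=> xyE lcx lcy tx xy dxy; apply/mapP; exists (x, y) => //.
  rewrite mem_cat [X in _ || X]mem_products lcx eqxx monicsE lcy eqxx /=.
  apply/orP; right; apply/andP; split; last by apply/eqP; lia.
  by lia.
have [ba|ab] := leqP (deg b) (deg a); first exact: (main b a).
by apply: (main a b) => //; rewrite 1?mulrC 1?addnC // ltnW.
Qed.

End FactorizationCounting.

(** * Asymptotic estimate *)

(** Strict convexity of n -> C(n + k, k): by Pascal its increments are C(n + k, k - 1), strictly
    increasing since k >= 2. *)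
Lemma bin_balance k j n : (1 < k)%N -> (j < n)%N ->
  ('C(j.+1 + k, k) + 'C(n + k, k) < 'C(j + k, k) + 'C(n.+1 + k, k))%N.
Proof.
case: k => [|[|k]] // _ jn; rewrite !addSn !(binS _ k.+1).
have : ('C(j + k.+2, k.+1) < 'C(n + k.+2, k.+1))%N.
  apply: (@leq_trans 'C((j + k.+2).+1, k.+1)); last by apply: leq_bin2l; lia.
  by rewrite binS -[X in (X < _)%N]addn0 ltn_add2l bin_gt0; lia.
by lia.
Qed.

Lemma sum_halving_le (a : nat -> nat) n :
  (forall i, (i.+1 < n)%N -> (2 * a i.+1 <= a i)%N) ->
  (\sum_(0 <= i < n) a i <= 2 * a 0)%N.
Proof.
elim: n a => [|n IHn] a a_half; first by rewrite big_nil.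
rewrite big_nat_recl //; case: n => [|n] in IHn a_half *.
  by rewrite big_nil; lia.
have := IHn (fun i => a i.+1) (fun i h => a_half i.+1 h).
by have := a_half 0%N isT; lia.
Qed.

(** By [bin_balance], raising the smaller degree by one lowers the total exponent, so each term is
    at most 1/q <= 1/2 of the one before, and the first dominates. *)
Lemma sum_balanced_le q k m t : (1 < q)%N -> (1 < k)%N -> (2 * t + 2 <= m)%N ->
  (\sum_(t.+1 <= j < (m./2).+1) q ^ 'C(j + k, k) * q ^ 'C(m - j + k, k)
    <= 2 * (q ^ 'C(t.+1 + k, k) * q ^ 'C(m - t.+1 + k, k)))%N.
Proof.
move=> q1 k1 tm; rewrite -{1}(add0n t.+1) big_addn subSS.
pose a i := (q ^ 'C(i + t.+1 + k, k) * q ^ 'C(m - (i + t.+1) + k, k))%N.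
apply: (@sum_halving_le a) => i hi.
rewrite /a -!expnD; set e := ('C(i.+1 + t.+1 + k, k) + _)%N.
apply: (@leq_trans (q * q ^ e)).
  by rewrite leq_mul2r q1 orbT.
rewrite -expnS leq_exp2l // /e.
have -> : (m - (i + t.+1) = (m - (i.+1 + t.+1)).+1)%N by lia.
by rewrite (addSn i); apply: bin_balance => //; lia.
Qed.

(** Regroups the triangle i + j <= t along the diagonals i + j = s. *)
Lemma triangular_sum (f : nat -> nat -> int) t :
  \sum_(i < t.+1) \sum_(j < (t - i).+1) f i j =
  \sum_(s < t.+1) \sum_(i < s.+1) f i (s - i)%N.
Proof.
elim: t => [|t IHt]; first by rewrite !big_ord1.
rewrite [RHS]big_ord_recr -IHt /= [LHS]big_ord_recr /=.
rewrite [X in _ = _ + X]big_ord_recr /= subnn big_ord1 addrA -big_split /=.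
congr (_ + _); apply: eq_bigr => i _.
by rewrite subSn ?big_ord_recr // -ltnS.
Qed.

(** * Convolution with the inverse series *)

Section Estimate.
Variables (F : finFieldType) (k : nat).
Hypothesis k_gt1 : (1 < k)%N.

Local Notation q := #|F|.
Local Notation N := (num_normalized F k).
Local Notation I := (num_irreducible F k).
Local Notation Q m := (q ^ 'C(m + k, k))%N.

Lemma card_field_gt1 : (1 < q)%N.
Proof. by rewrite (cardD1 0) (cardD1 1) !inE oner_neq0. Qed.

(** The difference is nonnegative and at most the balanced sum, whose factors are bounded by
    [num_normalized_le] before [sum_balanced_le] applies. *)
Lemma truncated_factorization_error m t : (3 * t + 2 <= m)%N ->
  `|(N m)%:Z - \sum_(j < t.+1) (N j)%:Z * (I (m - j))%:Z|
    <= (2 * (Q t.+1 * Q (m - t.+1)))%N%:Z.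
Proof.
move=> tm; have lower : (\sum_(j < t.+1) N j * I (m - j) <= N m)%N.
  by apply: sum_large_irreducible_factor_le; lia.
have upper := @le_sum_large_irreducible_factor F k m t tm.
have -> : \sum_(j < t.+1) (N j)%:Z * (I (m - j))%:Z =
    (\sum_(j < t.+1) N j * I (m - j))%N%:Z.
  by rewrite (big_morph Posz PoszD (erefl _)).
rewrite subzn // ger0_norm // lez_nat leq_subLR.
apply: leq_trans upper _; rewrite leq_add2l.
apply: leq_trans (sum_balanced_le card_field_gt1 k_gt1 _); last by lia.
by apply: leq_sum => j _; apply: leq_mul; apply: num_normalized_le.
Qed.

Variable alpha : nat -> int.
Hypotheses (alpha0 : alpha 0%N = 1)
  (alphaS : forall i : nat, (0 < i)%N ->
    alpha i = - \sum_(j < i) (N (i - j))%:Z * alpha j).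

(** For s > 0 the recursion is exactly the vanishing of this coefficient, the last term carrying N 0
    = 1. *)
Lemma alpha_convolution s :
  \sum_(i < s.+1) alpha i * (N (s - i))%:Z = (s == 0%N)%:R.
Proof.
rewrite big_ord_recr /= subnn num_normalized0 mulr1.
case: s => [|s]; first by rewrite big_ord0 add0r alpha0.
rewrite alphaS //; apply/eqP; rewrite subr_eq0; apply/eqP.
by apply: eq_bigr => i _; rewrite mulrC.
Qed.

(** Cutting the inner sum at t - i makes the index set the triangle i + j <= t; on each diagonal s,
    I (m - s) is multiplied by a coefficient of the convolution of [alpha] and [N], zero unless s =
    0. *)
Lemma num_irreducible_expansion m t :
  (I m)%:Z = \sum_(i < t.+1) alpha i *
    \sum_(j < (t - i).+1) (N j)%:Z * (I (m - i - j))%:Z.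
Proof.
under eq_bigr do rewrite mulr_sumr.
rewrite (triangular_sum (fun i j => alpha i * ((N j)%:Z * (I (m - i - j))%:Z))).
rewrite (eq_bigr (fun s : 'I_t.+1 => (s == 0%N :> nat)%:R * (I (m - s))%:Z)).
  by rewrite big_ord_recl /= mul1r subn0 big1 ?addr0.
move=> s _; rewrite -alpha_convolution mulr_suml; apply: eq_bigr => i _.
by rewrite mulrA -subnDA subnKC // -ltnS.
Qed.

(** The [i]-th inner sum approximates N (m - i) with truncation t - i, so that every error has the
    same order: (m - i) - (t - i + 1) = m - t - 1. *)
Lemma num_irreducible_estimate t m : (3 * t + 2 <= m)%N ->
  `|(I m)%:Z - \sum_(i < t.+1) alpha i * (N (m - i))%:Z|
  <= (\sum_(i < t.+1) `|alpha i|%N * (2 * Q (t - i).+1))%N%:Z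
     * (q%:Z ^+ 'C(m - t - 1 + k, k)).
Proof.
move=> tm; rewrite (num_irreducible_expansion m t) -sumrB.
apply: le_trans (ler_norm_sum _ _ _) _.
rewrite (big_morph Posz PoszD (erefl _)) mulr_suml; apply: ler_sum => i _.
have it : (i <= t)%N by rewrite -ltnS.
rewrite -mulrBr normrM distrC PoszM -abszE -mulrA ler_wpM2l //.
apply: le_trans (truncated_factorization_error _) _; first by lia.
have -> : (m - i - (t - i).+1 = m - t - 1)%N by lia.
by rewrite mulnA PoszM -!natz natrX natz.
Qed.

End Estimate.

Theorem theorem2p2 (q : nat) (F : finFieldType) (card_F : #|F| = q)
    (k t : nat) (k_ge2 : (2 <= k)%N)
    (alpha : nat -> int)
    (alpha0 : alpha 0%N = 1)
    (alphaS : forall i : nat, (0 < i)%N ->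
       alpha i = - \sum_(j < i) (num_normalized F k (i - j))%:Z * alpha j) :
  exists C M : nat, forall m : nat, (M <= m)%N ->
    `|(num_irreducible F k m)%:Z
      - \sum_(i < t.+1) alpha i * (num_normalized F k (m - i))%:Z|
    <= C%:Z * (q%:Z ^+ 'C(m - t - 1 + k, k)).
Proof.
(* The constant sums the errors over [i], so it is independent of [m]; the threshold is the one
   making every truncated factorization valid. *)
rewrite -card_F; exists (
  \sum_(i < t.+1) `|alpha i|%N * (2 * #|F| ^ 'C((t - i).+1 + k, k)))%N.
by exists (3 * t + 2)%N => m; apply: num_irreducible_estimate.
Qed.
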